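(* Let $G$ be a finite group such that $(G,Z(G))$ is a Camina pair and $Z(G) < G'$ (proper containment). Then $|Z(G)| < |G':Z(G)|^3$.
   Context: A pair $(G,N)$ is a Camina pair if $N$ is a normal subgroup of the finite group $G$ with $1 < N < G$ (i.e. $N$ is nontrivial and proper) and every element $g \in G \setminus N$ is conjugate in $G$ to every element of the coset $gN$. Here $Z(G)$ is the center of $G$ and $G'=[G,G]$ is the derived subgroup. *)

(* Defs.v *)
From mathcomp Require Import all_boot all_fingroup all_solvable.

Set Implicit Arguments.
Unset Strict Implicit.
Unset Printing Implicit Defensive.

Local Open Scope group_scope.

Definition Camina_pair (gT : finGroupType) (G N : {group gT}) : Prop :=
  [/\ N <| G, N :!=: 1, N \proper G
    & forall g, g \in G :\: N -> forall h, h \in g *: N -> h \in g ^: G].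

(* Main.v *)
Require Import Defs.
From mathcomp Require Import all_boot all_fingroup all_solvable.

Local Open Scope group_scope.

(** Conjugating x and y by g multiplies them by elements of G', and [~ x, y] is
    unchanged when x and y are multiplied by central elements. Hence the class
    of a commutator has at most |G' : Z(G)|^2 elements. Since G' is not central,
    some commutator c is not central, and by the Camina condition its class
    contains c Z(G); so in fact |Z(G)| <= |G' : Z(G)|^2. *)

Lemma commg_mul_center (gT : finGroupType) (G : {group gT}) (x y z t : gT) :
    x \in G -> y \in G -> z \in 'Z(G) -> t \in 'Z(G) ->
  [~ z * x, t * y] = [~ x, y].
Proof.
move=> Gx Gy /centerP[Gz cz] /centerP[Gt ct].
have zy : [~ z, t * y] = 1 by apply/eqP/commgP/cz; rewrite groupM.
have xt : [~ x, t] = 1 by apply/eqP/commgP/commute_sym/ct.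
by rewrite commMgJ zy conj1g mul1g commgMJ xt conj1g mulg1.
Qed.

Lemma card_class_commg (gT : finGroupType) (G : {group gT}) (x y : gT) :
    x \in G -> y \in G ->
  (#|[~ x, y] ^: G| <= #|G^`(1) : 'Z(G)| ^ 2)%N.
Proof.
move=> Gx Gy; set R := rcosets 'Z(G) G^`(1).
(* Pairs of cosets of the center account for the square of the index. The choice made by [repr] is
   harmless: it only changes a central factor. *)
pose f (u v : {set gT}) := [~ repr u * x, repr v * y].
have conjR a g : a \in G -> g \in G ->
    exists2 d, d \in G^`(1) & a ^ g = d * a.
  move=> Ga Gg; exists (a ^ g * a^-1); last by rewrite mulgKV.
  have -> : a ^ g * a^-1 = [~ g, a^-1].
    by rewrite commgEl !conjgE invgK !mulgA.
  by rewrite derg1 mem_commg ?groupV.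
have inR d : d \in G^`(1) -> 'Z(G) :* d \in R.
  by move=> Dd; rewrite mem_rcosets -[d]mul1g mem_mulg.
have sub : [~ x, y] ^: G \subset f @2: (R, R).
  apply/subsetP=> _ /imsetP[g Gg ->].
  have [d Dd xd] := conjR x g Gx Gg; have [e De ye] := conjR y g Gy Gg.
  apply/imset2P; exists ('Z(G) :* d) ('Z(G) :* e); try exact: inR.
  have sD := subsetP (der_sub 1 G).
  rewrite conjRg xd ye /f.
  (* The representatives are [z * d] and [t * e] with [z], [t] central, so both drop out of the
     commutator. *)
  case: repr_rcosetP => z Zz; case: repr_rcosetP => t Zt.
  by rewrite -!mulgA (@commg_mul_center _ G _ _ z t) // groupM // sD.
apply: leq_trans (subset_leq_card sub) _.
by rewrite curry_imset2X (leq_trans (leq_imset_card _ _)) // cardsX -mulnn.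
Qed.

Theorem theorem2 (gT : finGroupType) (G : {group gT})
    (hG : Camina_pair G 'Z(G)) (hZ : 'Z(G) \proper G^`(1)) :
  (#|'Z(G)| < #|G^`(1) : 'Z(G)| ^ 3)%N.
Proof.
have [_ _ _ conjZ] := hG.
have [_ nsub] := andP hZ.
have idx1 : (1 < #|G^`(1) : 'Z(G)|)%N by rewrite indexg_gt1.
move: nsub; rewrite derg1 gen_subG => /subsetPn[_ /imset2P[x y Gx Gy ->] ncZ].
have sub : [~ x, y] *: 'Z(G) \subset [~ x, y] ^: G.
  by apply/subsetP; apply: conjZ; rewrite inE ncZ groupR.
rewrite -(card_lcoset _ [~ x, y]).
apply: leq_ltn_trans (subset_leq_card sub) _.
apply: leq_ltn_trans (card_class_commg _ _ _ _ Gx Gy) _.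
(* Strictness comes only from here: the index exceeds 1, so its square is below its cube. *)
by rewrite ltn_exp2l.
Qed.
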